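(* 1. For any $\overline{L}\in\mathbb{N}$ and any $\overline{\mathbf{h}}\in\mathcal{M}^{\overline{L}}\cap\mathbb{R}^{S\times K}_*$: $\langle\overline{\mathbf{h}}\rangle$ is identifiable if and only if for every $L\in\mathbb{N}$ $$\left(P(\overline{\mathbf{h}})+\mathrm{Ker}(\mathcal{A})\right)\cap P(\mathcal{M}^L)\subset\{P(\overline{\mathbf{h}})\}.$$ 2. $\mathcal{M}$ is identifiable if and only if for all $L,L'\in\mathbb{N}$ $$\mathrm{Ker}(\mathcal{A})\cap\left(P(\mathcal{M}^L)-P(\mathcal{M}^{L'})\right)\subset\{0\}.$$
   Context: $K\geq 1$, $S\geq 2$ are integers, $[K]=\{1,\dots,K\}$, $[S]=\{1,\dots,S\}$. An element $\mathbf{h}\in\mathbb{R}^{S\times K}$ is a $K$-tuple of vectors $\mathbf{h}_1,\dots,\mathbf{h}_K\in\mathbb{R}^S$ with entries $\mathbf{h}_{k,i}$. $\mathbb{R}^{S^K}$ is the space of real order-$K$ tensors. $P:\mathbb{R}^{S\times K}\to\mathbb{R}^{S^K}$, $P(\mathbf{h})_{\mathbf{i}}=\mathbf{h}_{1,i_1}\cdots\mathbf{h}_{K,i_K}$ for $\mathbf{i}\in[S]^K$. $M_k:\mathbb{R}^S\to\mathbb{R}^{m_k\times m_{k+1}}$ ($k=1,\dots,K$, $m_1=m$, $m_{K+1}=n$) are linear maps and $\mathcal{A}:\mathbb{R}^{S^K}\to\mathbb{R}^{m\times n}$ is the unique linear map such that $M_1(\mathbf{h}_1)\cdots M_K(\mathbf{h}_K)=\mathcal{A}P(\mathbf{h})$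 for all $\mathbf{h}$. $\mathcal{M}=(\mathcal{M}^L)_{L\in\mathbb{N}}$ is a collection of models: each $\mathcal{M}^L$ is a nonempty subset of $\mathbb{R}^{S\times K}$. $P(\mathcal{M}^L)-P(\mathcal{M}^{L'})=\{P(\mathbf{h})-P(\mathbf{g}) : \mathbf{h}\in\mathcal{M}^L,\ \mathbf{g}\in\mathcal{M}^{L'}\}$. $\mathbb{R}^{S\times K}_*=\{\mathbf{h} : \mathbf{h}_k\neq0\ \forall k\in[K]\}$; on it, $\mathbf{h}\sim\mathbf{g}$ iff there are $\lambda_1,\dots,\lambda_K\in\mathbb{R}$ with $\prod_k\lambda_k=1$ and $\mathbf{h}_k=\lambda_k\mathbf{g}_k$ for all $k$; $\langle\mathbf{h}\rangle$ is the class of $\mathbf{h}$. Identifiability: for $\overline{\mathbf{h}}\in\mathcal{M}^{\overline L}\cap\mathbb{R}^{S\times K}_*$, put $X=M_1(\overline{\mathbf{h}}_1)\cdots M_K(\overline{\mathbf{h}}_K)=\mathcal{A}P(\overline{\mathbf{h}})$. $\langle\overline{\mathbf{h}}\rangle$ is identifiable if the elements of $\langle\overline{\mathbf{h}}\rangle$ are the only solutions of the problem of minimizing $\|M_1(\mathbf{h}_1)\cdots M_K(\mathbf{h}_K)-X\|^2$ over $L\in\mathbb{N}$, $\mathbf{h}\in\mathcal{M}^L$, i.e. every minimizer $\mathbf{h}^*$ (in any $\mathcal{M}^{L^*}$) belongs to $\langle\overline{\mathbf{h}}\rangle$. $\mathcal{M}$ is identifiable if for every $L\in\mathbb{N}$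 and every $\overline{\mathbf{h}}\in\mathcal{M}^L\cap\mathbb{R}^{S\times K}_*$, $\langle\overline{\mathbf{h}}\rangle$ is identifiable. *)

(* Defs.v *)
From HB Require Import structures.
From mathcomp Require Import all_boot all_order all_algebra.
From mathcomp Require Import boolp classical_sets reals.
Set Implicit Arguments.
Unset Strict Implicit.
Unset Printing Implicit Defensive.
Import Order.TTheory GRing.Theory Num.Theory.
Local Open Scope classical_set_scope.
Local Open Scope ring_scope.

(* [R^o] (rather than [R]) makes this an [lmodType R]. *)
Notation tensor R S K := {ffun {ffun 'I_K -> 'I_S} -> R^o}.

(* An element h of R^(S x K) is an S x K matrix: the vector h_k is [col k h]
   and the entry h_{k,i} is [h i k]. *)
Definition P (R : realType) (S K : nat) (h : 'M[R]_(S, K)) : tensor R S K :=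
  [ffun i : {ffun 'I_K -> 'I_S} => \prod_(k < K) h (i k) k].

(* The ordered product A_0 A_1 ... A_{K-1}, where A_k has size
   m_k x m_{k+1}; only m_0, ..., m_K matter. *)
Fixpoint mxchain (R : realType) (m : nat -> nat) (K : nat) :
    (forall k : 'I_K, 'M[R]_(m k, m k.+1)) -> 'M[R]_(m 0%N, m K) :=
  match K with
  | 0 => fun _ => 1%:M
  | K'.+1 => fun A =>
      mxchain (fun k : 'I_K' => A (widen_ord (leqnSn K') k)) *m A ord_max
  end.

Definition factor_product (R : realType) (S K : nat) (m : nat -> nat)
    (M : forall k : 'I_K, {linear 'cV[R]_S -> 'M[R]_(m k, m k.+1)})
    (h : 'M[R]_(S, K)) : 'M[R]_(m 0%N, m K) :=
  mxchain (fun k => M k (col k h)).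

(* The norm provided by MathComp-Analysis on matrices is the sup norm. *)
Definition frobenius_norm (R : realType) (p q : nat) (A : 'M[R]_(p, q)) : R :=
  Num.sqrt (\sum_(i < p) \sum_(j < q) A i j ^+ 2).

Definition nonzero_cols (R : realType) (S K : nat) : set 'M[R]_(S, K) :=
  [set h | forall k : 'I_K, col k h != 0].

Definition scaling_equiv (R : realType) (S K : nat) (h g : 'M[R]_(S, K)) :
    Prop :=
  exists lambda : 'I_K -> R,
    \prod_(k < K) lambda k = 1 /\
    forall k : 'I_K, col k h = lambda k *: col k g.

Definition scaling_class (R : realType) (S K : nat) (h : 'M[R]_(S, K)) :
    set 'M[R]_(S, K) :=
  [set g | nonzero_cols g /\ scaling_equiv g h].

Definition objective (R : realType) (S K : nat) (m : nat -> nat)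
    (M : forall k : 'I_K, {linear 'cV[R]_S -> 'M[R]_(m k, m k.+1)})
    (X : 'M[R]_(m 0%N, m K)) (h : 'M[R]_(S, K)) : R :=
  frobenius_norm (factor_product M h - X) ^+ 2.

(* The minimization ranges over both the model index and the parameter. *)
Definition is_minimizer (R : realType) (S K : nat) (m : nat -> nat)
    (M : forall k : 'I_K, {linear 'cV[R]_S -> 'M[R]_(m k, m k.+1)})
    (model : nat -> set 'M[R]_(S, K)) (X : 'M[R]_(m 0%N, m K))
    (L : nat) (h : 'M[R]_(S, K)) : Prop :=
  model L h /\
  forall (L' : nat) (g : 'M[R]_(S, K)),
    model L' g -> objective M X h <= objective M X g.

Definition class_identifiable (R : realType) (S K : nat) (m : nat -> nat)
    (M : forall k : 'I_K, {linear 'cV[R]_S -> 'M[R]_(m k, m k.+1)})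
    (model : nat -> set 'M[R]_(S, K)) (hbar : 'M[R]_(S, K)) : Prop :=
  forall (L : nat) (h : 'M[R]_(S, K)),
    is_minimizer M model (factor_product M hbar) L h -> scaling_class hbar h.

Definition model_identifiable (R : realType) (S K : nat) (m : nat -> nat)
    (M : forall k : 'I_K, {linear 'cV[R]_S -> 'M[R]_(m k, m k.+1)})
    (model : nat -> set 'M[R]_(S, K)) : Prop :=
  forall (L : nat) (hbar : 'M[R]_(S, K)),
    (model L `&` @nonzero_cols R S K) hbar -> class_identifiable M model hbar.

Definition Ker (R : realType) (U V : lmodType R) (A : {linear U -> V}) :
    set U :=
  [set x | A x = 0].

(* Main.v *)
Require Import Defs.
From HB Require Import structures.
From mathcomp Require Import all_boot all_order all_algebra.
From mathcomp Require Import boolp classical_sets reals.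
Set Implicit Arguments.
Unset Strict Implicit.
Unset Printing Implicit Defensive.
Import Order.TTheory GRing.Theory Num.Theory.
Local Open Scope classical_set_scope.
Local Open Scope ring_scope.

Lemma P_scaling (R : realType) (S K : nat) (h g : 'M[R]_(S, K)) :
  scaling_equiv h g -> P h = P g.
Proof.
case=> lam [lam1 hlam]; apply/ffunP => i; rewrite !ffunE.
have hE k : h (i k) k = lam k * g (i k) k.
  by have /matrixP/(_ (i k) 0) := hlam k; rewrite !mxE.
by rewrite (eq_bigr _ (fun k _ => hE k)) big_split /= lam1 mul1r.
Qed.

(** A zero column puts a zero factor into every entry of the tensor. This settles the pairs of
    tuples about which identifiability says nothing. *)
Lemma P_eq0 (R : realType) (S K : nat) (h : 'M[R]_(S, K)) :
  ~ nonzero_cols h -> P h = 0.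
Proof.
move=> /existsNP[k /negP]; rewrite negbK => /eqP hk.
apply/ffunP => i; rewrite !ffunE (bigD1 k) //=.
by have /matrixP/(_ (i k) 0) := hk; rewrite !mxE => ->; rewrite mul0r.
Qed.

(* Fix a multi-index i where P g does not vanish; the scalars are the ratios of
   the entries of h and g along i, and changing i in the single coordinate k
   propagates the ratio to the whole column k. *)
Lemma P_inj_scaling_class (R : realType) (S K : nat) (h g : 'M[R]_(S, K)) :
  nonzero_cols g -> P h = P g -> scaling_class g h.
Proof.
move=> g0 hg.
have /choice[i gi0] k : exists s, g s k != 0.
  by have /cV0Pn[s] := g0 k; rewrite mxE; exists s.
have PE (j : 'I_K -> 'I_S) : \prod_k h (j k) k = \prod_k g (j k) k.
  have /ffunP/(_ (finfun j)) := hg; rewrite !ffunE.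
  by congr (_ = _); apply: eq_bigr => k _; rewrite ffunE.
have Pg0 : \prod_k g (i k) k != 0 by apply/prodf_neq0.
have hi0 k : h (i k) k != 0.
  by have := Pg0; rewrite -PE => /prodf_neq0 ->.
split.
  by move=> k; apply/cV0Pn; exists (i k); rewrite mxE.
exists (fun k => h (i k) k / g (i k) k); split.
  by rewrite prodf_div PE divff.
move=> k; apply/matrixP => s z; rewrite !mxE.
have := PE i; rewrite (bigD1 k) //= [RHS](bigD1 k) //= => PEi.
have := PE (fun l => if l == k then s else i l).
rewrite (bigD1 k) //= [RHS](bigD1 k) //= eqxx.
under eq_bigr => l lk do rewrite (negbTE lk).
under [in RHS]eq_bigr => l lk do rewrite (negbTE lk).
(* The factors at indices other than [k] are the same for [i] and for its modification at [k]. The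
   product [p] of those of [h] is nonzero, so it can be cancelled; the equation at [i] then trades
   it for the product [q] of those of [g]. *)
have : \prod_(l < K | l != k) h (i l) l != 0 by apply/prodf_neq0.
move: PEi; set p := \prod_(_ < _ | _) _; set q := \prod_(_ < _ | _) _.
move=> PEi p0 PEs; apply: (mulIf p0); rewrite PEs.
by rewrite [RHS]mulrAC [_ / _ * p]mulrAC PEi [_ * q / _]mulrAC 
  divff// mul1r mulrC.
Qed.

(** The hypothesis is an inequality because comparison with a point of objective value 0 gives only
    an upper bound. *)
Lemma frobenius_norm_sqr_le0 (R : realType) (p q : nat) (A : 'M[R]_(p, q)) :
  frobenius_norm A ^+ 2 <= 0 -> A = 0.
Proof.
have row0 i : 0 <= \sum_(j < q) A i j ^+ 2.
  by apply: sumr_ge0 => j _; exact: sqr_ge0.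
rewrite sqr_sqrtr; last by apply: sumr_ge0 => i _; exact: row0.
move=> le0; apply/matrixP => i j; rewrite mxE; apply/eqP.
have : \sum_i \sum_(j < q) A i j ^+ 2 == 0.
  by rewrite eq_le le0 sumr_ge0.
rewrite psumr_eq0 // => /allP/(_ i (mem_index_enum i)) /=.
rewrite psumr_eq0 => [|l _]; last exact: sqr_ge0.
by move=> /allP/(_ j (mem_index_enum j)) /=; rewrite sqrf_eq0.
Qed.

Lemma objective_eq0 (R : realType) (S K : nat) (m : nat -> nat)
    (M : forall k : 'I_K, {linear 'cV[R]_S -> 'M[R]_(m k, m k.+1)})
    (X : 'M[R]_(m 0%N, m K)) (h : 'M[R]_(S, K)) :
  factor_product M h = X -> objective M X h = 0.
Proof.
move=> <-; rewrite /objective /frobenius_norm subrr.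
rewrite big1 ?sqrtr0 ?expr0n// => i _; rewrite big1// => j _.
by rewrite mxE expr0n.
Qed.

(* The data X is attained by the model, so the minimum of the objective is 0. *)
Lemma is_minimizerP (R : realType) (S K : nat) (m : nat -> nat)
    (M : forall k : 'I_K, {linear 'cV[R]_S -> 'M[R]_(m k, m k.+1)})
    (model : nat -> set 'M[R]_(S, K)) (Lbar : nat) (hbar : 'M[R]_(S, K))
    (L : nat) (h : 'M[R]_(S, K)) :
  model Lbar hbar ->
  is_minimizer M model (factor_product M hbar) L h <->
  model L h /\ factor_product M h = factor_product M hbar.
Proof.
move=> mbar; split=> -[mh].
  move=> /(_ Lbar hbar mbar); rewrite [leRHS]objective_eq0 //.
  by move=> /frobenius_norm_sqr_le0 /subr0_eq.
move=> hE; split=> // L' g _.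
by rewrite objective_eq0 // /objective exprn_ge0 // sqrtr_ge0.
Qed.

(** Minimizers are the exact solutions in the models, and membership in the class of [hbar] amounts
    to having the same tensor, since [hbar] has no zero column. Both parts of the theorem reduce to
    this criterion. *)
Lemma class_identifiableP (R : realType) (S K : nat) (m : nat -> nat)
    (M : forall k : 'I_K, {linear 'cV[R]_S -> 'M[R]_(m k, m k.+1)})
    (model : nat -> set 'M[R]_(S, K)) (Lbar : nat) (hbar : 'M[R]_(S, K)) :
  (model Lbar `&` @nonzero_cols R S K) hbar ->
  class_identifiable M model hbar <->
  forall L h, model L h -> factor_product M h = factor_product M hbar ->
    P h = P hbar.
Proof.
move=> [mbar bar0]; split=> [idh L h mh hE|inj L h].
  have [] : scaling_class hbar h by apply: (idh L); apply/(is_minimizerP _ _ _ mbar).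
  by move=> _ /P_scaling.
move=> /(is_minimizerP _ _ _ mbar)[mh hE].
exact: P_inj_scaling_class (inj L h mh hE).
Qed.

Theorem proposition6p3 (R : realType) (K S : nat) (hK : (1 <= K)%N)
    (hS : (2 <= S)%N) (m : nat -> nat)
    (M : forall k : 'I_K, {linear 'cV[R]_S -> 'M[R]_(m k, m k.+1)})
    (A : {linear tensor R S K -> 'M[R]_(m 0%N, m K)})
    (hA : forall h : 'M[R]_(S, K), factor_product M h = A (P h))
    (model : nat -> set 'M[R]_(S, K))
    (hmodel : forall L : nat, model L !=set0) :
  (forall (Lbar : nat) (hbar : 'M[R]_(S, K)),
      (model Lbar `&` @nonzero_cols R S K) hbar ->
      (class_identifiable M model hbar <->
       forall L : nat,
         [set P hbar + T | T in Ker A] `&` [set P h | h in model L]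
           `<=` [set P hbar])) /\
  (model_identifiable M model <->
   forall L L' : nat,
     Ker A `&` [set P h - P g | h in model L & g in model L'] `<=` [set 0]).
Proof.
split=> [Lbar hbar hb|].
  rewrite (class_identifiableP M hb); split=> [inj L T|sub L h mh].
    move=> [[U AU <-]] [h mh hE]; rewrite /= -hE; apply: (inj L h mh).
    by rewrite !hA hE linearD AU addr0.
  rewrite !hA => hE; apply: (sub L); split; last by exists h.
  (* Equal factor products mean that [A] agrees on the two tensors, so their difference is the
     required kernel element. *)
  exists (P h - P hbar); last by rewrite addrC subrK.
  by rewrite /Ker /= linearB /= hE subrr.
split=> [idM L L' T [AT [h mh [g mg TE]]]|sub L hbar hb].
  have hg : factor_product M h = factor_product M g.
    by move: AT; rewrite -TE /Ker /= linearB /= !hA => /subr0_eq.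
  rewrite /= -TE; apply/eqP; rewrite subr_eq0; apply/eqP.
  (* Identifiability applies only at a reference point without zero columns: [h] serves if possible,
     otherwise [g]. If neither qualifies, both tensors vanish. *)
  have [h0|h0] := pselect (nonzero_cols h).
    have hb : (model L `&` @nonzero_cols R S K) h by [].
    by apply/esym; apply: (class_identifiableP M hb).1 mg _; first exact: idM hb.
  have [g0|g0] := pselect (nonzero_cols g); last by rewrite !P_eq0.
  have gb : (model L' `&` @nonzero_cols R S K) g by [].
  by apply: (class_identifiableP M gb).1 mh _; first exact: idM gb.
(* Conversely, the difference of the tensors of an exact solution [h] and of [hbar] lies in the
   kernel, hence is zero. *)
apply/(class_identifiableP M hb) => L' h mh; rewrite !hA => hE.
apply/eqP; rewrite -subr_eq0; apply/eqP; apply: (sub L' L); split.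
  by rewrite /Ker /= linearB /= hE subrr.
by exists h => //; exists hbar => //; case: hb.
Qed.
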